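(* Let $K=(\mathcal T,\emptyset)$ be an $\mathcal{ALC}$ knowledge base with empty ABox, let $R_1,\dots,R_k$ be the role names and $A_1,\dots,A_n$ the concept names occurring in $K$. For all $\mathcal{ALC}$ concepts $C$ and $D$ built from the concept names and role names of $K$: $$K\models_{\mathcal{ALC}}C\sqsubseteq D$$ if and only if $$\Omega\vdash\forall x\,\forall y_1\cdots\forall y_k\Bigl(\mathit{Trans}^2(x)\rightarrow\forall x_1\cdots\forall x_n\bigl(\textstyle\bigwedge \mathit{TBox}_{\mathcal T}\rightarrow C^S\cap x\subseteq D^S\bigr)\Bigr),$$ where $\mathit{Trans}^2(x)$ stands for $\forall y\,\forall z\,(y\in z\wedge z\in x\rightarrow y\subseteq x)$, that is, $x\subseteq \mathit{Pow}(\mathit{Pow}(x))$.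
   Context: **$\mathcal{ALC}$.** The standard description logic with concepts built from concept names, $\top$, $\bot$ by $\sqcap,\sqcup,\neg,\forall R.C,\exists R.C$, interpreted over non-empty domains as usual; a TBox $\mathcal T$ is a finite set of inclusions $C_1\sqsubseteq C_2$ (satisfied in $I$ iff $C_1^I\subseteq C_2^I$). $K\models_{\mathcal{ALC}}C\sqsubseteq D$ means that every interpretation satisfying $\mathcal T$ satisfies $C\sqsubseteq D$. **The theory $\Omega$.** First-order theory with binary relation symbols $\in,\subseteq$, binary function symbols $\cup,\backslash$ and a unary function symbol $\mathit{Pow}$, with axioms (universally closed): (1) $x\in y\cup z\leftrightarrow x\in y\vee x\in z$; (2) $x\in y\backslash z\leftrightarrow x\in y\wedge x\notin z$; (3) $x\subseteq y\leftrightarrow\forall z(z\in x\to z\in y)$; (4) $x\in \mathit{Pow}(y)\leftrightarrow x\subseteq y$. No extensionality or well-foundedness is assumed. $\Omega\vdash\varphi$ denotes first-order derivability from these axioms. In terms, $s\cap t$ abbreviates $s\backslash(s\backslash t)$ and $\emptyset$ abbreviates $x\backslash x$. **Translation.** For an $\mathcal{ALC}$ concept $C$ over the names of $K$, the set-theoretic term $C^S(x,y_1,\dots,y_k,x_1,\dots,x_n)$ (in set variables $x,y_i,x_j$) is defined inductively by: $\top^S=x$; $\bot^S=\emptyset$; $A_i^S=x_i$; $(\neg C)^S=x\backslash C^S$; $(C\sqcap D)^S=C^S\cap D^S$; $(C\sqcup D)^S=C^S\cup D^S$; $(\forall R_i.C)^S=\mathit{Pow}\bigl(((x\cup y_1\cup\dots\cup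 y_k)\backslash y_i)\cup \mathit{Pow}(C^S)\bigr)$; $(\exists R_i.C)^S=(\neg\forall R_i.\neg C)^S$. The TBox is translated as $\mathit{TBox}_{\mathcal T}=\{C_1^S\cap x\subseteq C_2^S\mid C_1\sqsubseteq C_2\in\mathcal T\}$. *)

(* Defs.v *)
From HB Require Import structures.
From mathcomp Require Import all_boot.
Set Implicit Arguments.
Unset Strict Implicit.
Unset Printing Implicit Defensive.

Inductive concept (NC NR : Type) : Type :=
| CTop
| CBot
| CName of NC
| CNot of concept NC NR
| CAnd of concept NC NR & concept NC NR
| COr of concept NC NR & concept NC NR
| CAll of NR & concept NC NR
| CEx of NR & concept NC NR.

Arguments CTop {NC NR}.
Arguments CBot {NC NR}.
Arguments CName {NC NR} _.

Record interpretation (NC NR : Type) : Type := Interpretation {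
  domain : Type;
  domain_point : domain;
  name_int : NC -> domain -> Prop;
  role_int : NR -> domain -> domain -> Prop
}.

Fixpoint extension (NC NR : Type) (I : interpretation NC NR)
    (C : concept NC NR) : domain I -> Prop :=
  match C with
  | CTop => fun _ => True
  | CBot => fun _ => False
  | CName A => name_int A
  | CNot C1 => fun d => ~ extension C1 d
  | CAnd C1 C2 => fun d => extension C1 d /\ extension C2 d
  | COr C1 C2 => fun d => extension C1 d \/ extension C2 d
  | CAll R C1 => fun d => forall e, role_int R d e -> extension C1 e
  | CEx R C1 => fun d => exists2 e, role_int R d e & extension C1 e
  end.

Definition satisfies_incl (NC NR : Type) (I : interpretation NC NR)
    (C D : concept NC NR) : Prop :=
  forall d : domain I, extension C d -> extension D d.

(* The pair (C1, C2) stands for the inclusion C1 [= C2. *)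
Definition tbox (NC NR : Type) : Type := seq (concept NC NR * concept NC NR).

Fixpoint satisfies_tbox (NC NR : Type) (I : interpretation NC NR)
    (T : tbox NC NR) : Prop :=
  if T is (C1, C2) :: T' then satisfies_incl I C1 C2 /\ satisfies_tbox I T'
  else True.

Definition alc_entails (NC NR : Type) (T : tbox NC NR)
    (C D : concept NC NR) : Prop :=
  forall I : interpretation NC NR, satisfies_tbox I T -> satisfies_incl I C D.

Fixpoint concept_names (NC NR : Type) (C : concept NC NR) : seq NC :=
  match C with
  | CTop | CBot => [::]
  | CName A => [:: A]
  | CNot C1 | CAll _ C1 | CEx _ C1 => concept_names C1
  | CAnd C1 C2 | COr C1 C2 => concept_names C1 ++ concept_names C2
  end.

Fixpoint role_names (NC NR : Type) (C : concept NC NR) : seq NR :=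
  match C with
  | CTop | CBot | CName _ => [::]
  | CNot C1 => role_names C1
  | CAll R C1 | CEx R C1 => R :: role_names C1
  | CAnd C1 C2 | COr C1 C2 => role_names C1 ++ role_names C2
  end.

Definition tbox_concept_names (NC NR : Type) (T : tbox NC NR) : seq NC :=
  flatten [seq concept_names CD.1 ++ concept_names CD.2 | CD <- T].

Definition tbox_role_names (NC NR : Type) (T : tbox NC NR) : seq NR :=
  flatten [seq role_names CD.1 ++ role_names CD.2 | CD <- T].

(* De Bruijn representation: [Var 0] refers to the innermost quantifier. *)
Inductive term : Type :=
| Var of nat
| Cup of term & term
| Diff of term & term
| Pow of term.

Inductive formula : Type :=
| Elem of term & term
| Incl of term & term
| Bot
| Imp of formula & formula
| And of formula & formula
| Or of formula & formula
| All of formula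
| Ex of formula.

Definition Not (phi : formula) : formula := Imp phi Bot.
Definition Iff (phi psi : formula) : formula := And (Imp phi psi) (Imp psi phi).
Definition BigAnd (s : seq formula) : formula := foldr And (Not Bot) s.

Lemma term_comparable : comparable term.
Proof. by rewrite /comparable /decidable; decide equality; decide equality. Qed.
HB.instance Definition _ := hasDecEq.Build term (compareP term_comparable).

Lemma formula_comparable : comparable formula.
Proof.
by rewrite /comparable /decidable; decide equality; apply: term_comparable.
Qed.
HB.instance Definition _ := hasDecEq.Build formula (compareP formula_comparable).

Fixpoint tsubst (sigma : nat -> term) (t : term) : term :=
  match t with
  | Var n => sigma n
  | Cup t1 t2 => Cup (tsubst sigma t1) (tsubst sigma t2)
  | Diff t1 t2 => Diff (tsubst sigma t1) (tsubst sigma t2)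
  | Pow t1 => Pow (tsubst sigma t1)
  end.

Definition tlift (m : nat) (t : term) : term := tsubst (fun n => Var (m + n)) t.

Definition up (sigma : nat -> term) (n : nat) : term :=
  if n is n'.+1 then tlift 1 (sigma n') else Var 0.

Fixpoint fsubst (sigma : nat -> term) (phi : formula) : formula :=
  match phi with
  | Elem s t => Elem (tsubst sigma s) (tsubst sigma t)
  | Incl s t => Incl (tsubst sigma s) (tsubst sigma t)
  | Bot => Bot
  | Imp phi1 phi2 => Imp (fsubst sigma phi1) (fsubst sigma phi2)
  | And phi1 phi2 => And (fsubst sigma phi1) (fsubst sigma phi2)
  | Or phi1 phi2 => Or (fsubst sigma phi1) (fsubst sigma phi2)
  | All phi1 => All (fsubst (up sigma) phi1)
  | Ex phi1 => Ex (fsubst (up sigma) phi1)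
  end.

Definition flift (phi : formula) : formula := fsubst (fun n => Var n.+1) phi.

(* Instantiates [Var 0] by [t] in the body of a quantifier. *)
Definition finst (phi : formula) (t : term) : formula :=
  fsubst (fun n => if n is n'.+1 then Var n' else t) phi.

(* Classical natural deduction.  Lifting the other formulas in [AllI] and [ExE]
   makes [Var 0] fresh for them, which is the eigenvariable condition. *)
Inductive derivable : seq formula -> formula -> Prop :=
| Ax G phi : phi \in G -> derivable G phi
| Contra G phi : derivable (Not phi :: G) Bot -> derivable G phi
| ImpI G phi psi : derivable (phi :: G) psi -> derivable G (Imp phi psi)
| ImpE G phi psi :
    derivable G (Imp phi psi) -> derivable G phi -> derivable G psi
| AndI G phi psi :
    derivable G phi -> derivable G psi -> derivable G (And phi psi)
| AndE1 G phi psi : derivable G (And phi psi) -> derivable G phi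
| AndE2 G phi psi : derivable G (And phi psi) -> derivable G psi
| OrI1 G phi psi : derivable G phi -> derivable G (Or phi psi)
| OrI2 G phi psi : derivable G psi -> derivable G (Or phi psi)
| OrE G phi psi chi :
    derivable G (Or phi psi) -> derivable (phi :: G) chi ->
    derivable (psi :: G) chi -> derivable G chi
| AllI G phi : derivable [seq flift psi | psi <- G] phi -> derivable G (All phi)
| AllE G phi t : derivable G (All phi) -> derivable G (finst phi t)
| ExI G phi t : derivable G (finst phi t) -> derivable G (Ex phi)
| ExE G phi chi :
    derivable G (Ex phi) ->
    derivable (phi :: [seq flift psi | psi <- G]) (flift chi) ->
    derivable G chi.

(* In the axioms with three variables, x, y, z are [Var 2], [Var 1], [Var 0];
   in those with two, x and y are [Var 1] and [Var 0], and inside the inner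
   quantifier over z of [ax_incl] they become [Var 2] and [Var 1]. *)
Definition ax_cup : formula :=
  All (All (All (Iff (Elem (Var 2) (Cup (Var 1) (Var 0)))
                     (Or (Elem (Var 2) (Var 1)) (Elem (Var 2) (Var 0)))))).

Definition ax_diff : formula :=
  All (All (All (Iff (Elem (Var 2) (Diff (Var 1) (Var 0)))
                     (And (Elem (Var 2) (Var 1)) (Not (Elem (Var 2) (Var 0))))))).

Definition ax_incl : formula :=
  All (All (Iff (Incl (Var 1) (Var 0))
                (All (Imp (Elem (Var 0) (Var 2)) (Elem (Var 0) (Var 1)))))).

Definition ax_pow : formula :=
  All (All (Iff (Elem (Var 1) (Pow (Var 0))) (Incl (Var 1) (Var 0)))).

Definition Omega : seq formula := [:: ax_cup; ax_diff; ax_incl; ax_pow].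

Definition Cap (s t : term) : term := Diff s (Diff s t).

(* forall y z, y \in z /\ z \in x -> y \subseteq x, with y and z bound as
   [Var 1] and [Var 0]. *)
Definition Trans2 (x : term) : formula :=
  All (All (Imp (And (Elem (Var 1) (Var 0)) (Elem (Var 0) (tlift 2 x)))
                (Incl (Var 1) (tlift 2 x)))).

(* The lists Rs = [R_1; ...; R_k] and As = [A_1; ...; A_n] enumerate the role
   and concept names.  The translated terms live under the quantifier prefix
   x, y_1, ..., y_k, x_1, ..., x_n (outermost first), whence the indices
   n + k for x, n + (k - i) for y_i and n - j for x_j.  The values at names
   outside the lists are junk. *)

Definition x_var (NC NR : Type) (Rs : seq NR) (As : seq NC) : term :=
  Var (size As + size Rs).

Definition y_var (NC : Type) (NR : eqType) (Rs : seq NR) (As : seq NC)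
    (R : NR) : term :=
  Var (size As + (size Rs - (index R Rs).+1)).

Definition name_var (NC : eqType) (As : seq NC) (A : NC) : term :=
  Var (size As - (index A As).+1).

(* x \cup y_1 \cup ... \cup y_k, associated to the left. *)
Definition xy_union (NC : Type) (NR : eqType) (Rs : seq NR) (As : seq NC) :
    term :=
  foldl (fun t R => Cup t (y_var Rs As R)) (x_var Rs As) Rs.

Definition all_set (NC : Type) (NR : eqType) (Rs : seq NR) (As : seq NC)
    (R : NR) (t : term) : term :=
  Pow (Cup (Diff (xy_union Rs As) (y_var Rs As R)) (Pow t)).

Fixpoint concept_set (NC NR : eqType) (Rs : seq NR) (As : seq NC)
    (C : concept NC NR) : term :=
  let x := x_var Rs As in
  match C with
  | CTop => x
  | CBot => Diff x x
  | CName A => name_var As A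
  | CNot C1 => Diff x (concept_set Rs As C1)
  | CAnd C1 C2 => Cap (concept_set Rs As C1) (concept_set Rs As C2)
  | COr C1 C2 => Cup (concept_set Rs As C1) (concept_set Rs As C2)
  | CAll R C1 => all_set Rs As R (concept_set Rs As C1)
  | CEx R C1 => Diff x (all_set Rs As R (Diff x (concept_set Rs As C1)))
  end.

Definition incl_formula (NC NR : eqType) (Rs : seq NR) (As : seq NC)
    (C D : concept NC NR) : formula :=
  Incl (Cap (concept_set Rs As C) (x_var Rs As)) (concept_set Rs As D).

Definition tbox_formulas (NC NR : eqType) (Rs : seq NR) (As : seq NC)
    (T : tbox NC NR) : seq formula :=
  [seq incl_formula Rs As CD.1 CD.2 | CD <- T].

(* Main.v *)
(* Soundness and completeness of the calculus reduce the claim to a comparison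
   of countermodels.  In a model of Omega with Trans^2(x), the members of x form
   an interpretation in which R_i(s, u) holds when u is a member of some t in s
   that lies in y_i or outside x \cup y_1 \cup ... \cup y_k; Trans^2(x) keeps u
   in x.  Conversely, an interpretation is turned into a membership relation on
   atoms, with one atom per world w and one per pair (w, R), and the
   well-founded trees over these atoms, compared up to bisimulation as in
   Aczel's interpretation of set theory, form a model of Omega. *)

Require Import Defs.
From mathcomp Require Import all_boot.
From Stdlib Require Import ClassicalEpsilon FunctionalExtensionality.
Set Implicit Arguments.
Unset Strict Implicit.
Unset Printing Implicit Defensive.

Definition scons (A : Type) (a : A) (s : nat -> A) (n : nat) : A :=
  if n is n'.+1 then s n' else a.

Lemma scons_eta (A : Type) (s : nat -> A) :
  s = scons (s 0) (fun n => s n.+1).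
Proof. by apply: functional_extensionality; case. Qed.

(** * Substitutions *)

Lemma tsubst_id t : tsubst Var t = t.
Proof. by elim: t => //= [s -> t ->|s -> t ->|t ->]. Qed.

Lemma tsubst_comp s s' t :
  tsubst s (tsubst s' t) = tsubst (fun n => tsubst s (s' n)) t.
Proof. by elim: t => //= [t -> t' ->|t -> t' ->|t ->]. Qed.

Lemma up_id : up Var = Var.
Proof. by apply: functional_extensionality; case. Qed.

Lemma up_comp s s' :
  (fun n => tsubst (up s) (up s' n)) = up (fun n => tsubst s (s' n)).
Proof.
by apply: functional_extensionality; case=> //= n; rewrite /tlift !tsubst_comp.
Qed.

Lemma fsubst_id phi : fsubst Var phi = phi.
Proof.
by elim: phi => //= [s t|s t|a -> b ->|a -> b ->|a -> b ->|a|a];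
   rewrite ?tsubst_id ?up_id // => ->.
Qed.

Lemma fsubst_comp s s' phi :
  fsubst s (fsubst s' phi) = fsubst (fun n => tsubst s (s' n)) phi.
Proof.
by elim: phi s s' => //= [t t'|t t'|a IHa b IHb|a IHa b IHb|a IHa b IHb|a IHa|a IHa] s s';
   rewrite ?tsubst_comp ?IHa ?IHb ?up_comp.
Qed.

Lemma flift_fsubst s phi : flift (fsubst s phi) = fsubst (up s) (flift phi).
Proof. by rewrite /flift !fsubst_comp. Qed.

Lemma finst_fsubst_up s phi t :
  finst (fsubst (up s) phi) t = fsubst (scons t s) phi.
Proof.
rewrite /finst fsubst_comp; congr fsubst.
apply: functional_extensionality; case=> //= n.
by rewrite /tlift tsubst_comp -[RHS]tsubst_id.
Qed.

Lemma fsubst_finst s phi t :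
  fsubst s (finst phi t) = finst (fsubst (up s) phi) (tsubst s t).
Proof.
rewrite finst_fsubst_up fsubst_comp; congr fsubst.
by apply: functional_extensionality; case.
Qed.

(** Under the binder [Var 0] stays fixed and the lift of the other variables is undone, so [phi] is
    the instance of its own lift at the eigenvariable. *)
Lemma finst_lift phi : finst (fsubst (up (fun n => Var n.+1)) phi) (Var 0) = phi.
Proof.
rewrite finst_fsubst_up -[RHS]fsubst_id; congr fsubst.
by apply: functional_extensionality; case.
Qed.

Fixpoint tbound (t : term) : nat :=
  match t with
  | Var n => n.+1
  | Cup t1 t2 | Diff t1 t2 => maxn (tbound t1) (tbound t2)
  | Pow t1 => tbound t1
  end.

(** A strict upper bound on the indices of the free variables: every variable from this index on is
    fresh. The predecessor accounts for the binder. *)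
Fixpoint fbound (phi : formula) : nat :=
  match phi with
  | Elem s t | Incl s t => maxn (tbound s) (tbound t)
  | Bot => 0
  | Imp a b | And a b | Or a b => maxn (fbound a) (fbound b)
  | All a | Ex a => (fbound a).-1
  end.

Lemma tsubst_eq s s' t :
  (forall n, n < tbound t -> s n = s' n) -> tsubst s t = tsubst s' t.
Proof.
elim: t => //= [n ->//|t1 IH1 t2 IH2 E|t1 IH1 t2 IH2 E|t IH E].
- by rewrite IH1 ?IH2 // => n ltn; apply: E; rewrite leq_max ltn ?orbT.
- by rewrite IH1 ?IH2 // => n ltn; apply: E; rewrite leq_max ltn ?orbT.
- by rewrite IH.
Qed.

Lemma up_eq s s' m :
  (forall n, n < m.-1 -> s n = s' n) -> forall n, n < m -> up s n = up s' n.
Proof. by move=> E [|n] //= ltn; rewrite E // ltn_predRL. Qed.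

Lemma fsubst_eq s s' phi :
  (forall n, n < fbound phi -> s n = s' n) -> fsubst s phi = fsubst s' phi.
Proof.
elim: phi s s' => //= [t t'|t t'|a IHa b IHb|a IHa b IHb|a IHa b IHb|a IHa|a IHa] s s' E;
  try by [rewrite (IHa _ _ (up_eq E))].
all: try by rewrite !(@tsubst_eq s s') // => n ltn; apply: E;
  rewrite leq_max ltn ?orbT.
all: by rewrite (IHa s s') ?(IHb s s') // => n ltn; apply: E;
  rewrite leq_max ltn ?orbT.
Qed.

(** * Natural deduction *)

(** Only membership in the context counts, so this covers exchange and contraction as well. *)
Lemma derivable_weaken G G' phi :
  derivable G phi -> {subset G <= G'} -> derivable G' phi.
Proof.
have cons_sub psi (L L' : seq formula) :
    {subset L <= L'} -> {subset psi :: L <= psi :: L'}.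
  by move=> sLL' x; rewrite !inE => /orP[->//|/sLL' ->]; rewrite orbT.
have map_sub (L L' : seq formula) :
    {subset L <= L'} -> {subset map flift L <= map flift L'}.
  by move=> sLL' x /mapP[y /sLL' yL' ->]; apply: map_f.
move=> d; elim: d G' => {G phi}.
- by move=> G phi phiG G' sGG'; apply/Ax/sGG'.
- by move=> G phi _ IH G' sGG'; apply/Contra/IH/cons_sub.
- by move=> G phi psi _ IH G' sGG'; apply/ImpI/IH/cons_sub.
- by move=> G phi psi _ IH1 _ IH2 G' sGG'; apply: ImpE (IH1 _ _) (IH2 _ _).
- by move=> G phi psi _ IH1 _ IH2 G' sGG'; apply: AndI (IH1 _ _) (IH2 _ _).
- by move=> G phi psi _ IH G' sGG'; apply: AndE1 (IH _ _).
- by move=> G phi psi _ IH G' sGG'; apply: AndE2 (IH _ _).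
- by move=> G phi psi _ IH G' sGG'; apply: OrI1 (IH _ _).
- by move=> G phi psi _ IH G' sGG'; apply: OrI2 (IH _ _).
- move=> G phi psi chi _ IH _ IH1 _ IH2 G' sGG'.
  by apply: OrE (IH _ _) (IH1 _ _) (IH2 _ _) => //; apply: cons_sub.
- by move=> G phi _ IH G' sGG'; apply/AllI/IH/map_sub.
- by move=> G phi t _ IH G' sGG'; apply/AllE/IH.
- by move=> G phi t _ IH G' sGG'; apply/ExI/IH.
- move=> G phi chi _ IH _ IH1 G' sGG'.
  by apply: ExE (IH _ _) (IH1 _ _) => //; apply/cons_sub/map_sub.
Qed.

(** Lifting commutes with substitution once [s] is replaced by [up s], which preserves the
    eigenvariable condition. The completeness proof uses this to rename a fresh variable. *)
Lemma derivable_subst G phi s :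
  derivable G phi -> derivable [seq fsubst s psi | psi <- G] (fsubst s phi).
Proof.
have mapE (L : seq formula) s0 :
    [seq fsubst (up s0) psi | psi <- [seq flift psi | psi <- L]] =
    [seq flift psi | psi <- [seq fsubst s0 psi | psi <- L]].
  by rewrite -!map_comp; apply: eq_map => psi /=; rewrite flift_fsubst.
move=> d; elim: d s => {G phi}.
- by move=> G phi phiG s; apply/Ax/map_f.
- by move=> G phi _ IH s; apply/Contra/IH.
- by move=> G phi psi _ IH s; apply/ImpI/IH.
- by move=> G phi psi _ IH1 _ IH2 s; apply: ImpE (IH1 _) (IH2 _).
- by move=> G phi psi _ IH1 _ IH2 s; apply: AndI (IH1 _) (IH2 _).
- by move=> G phi psi _ IH s; apply: AndE1 (IH _).
- by move=> G phi psi _ IH s; apply: AndE2 (IH _).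
- by move=> G phi psi _ IH s; apply: OrI1 (IH _).
- by move=> G phi psi _ IH s; apply: OrI2 (IH _).
- by move=> G phi psi chi _ IH _ IH1 _ IH2 s; apply: OrE (IH _) (IH1 _) (IH2 _).
- by move=> G phi _ IH s; apply: AllI; rewrite -mapE; apply: IH.
- by move=> G phi t _ IH s; rewrite fsubst_finst; apply/AllE/IH.
- move=> G phi t _ IH s; apply: (ExI (t := tsubst s t)).
  by rewrite -fsubst_finst; apply: IH.
- move=> G phi chi _ IH _ IH1 s; apply: ExE (IH _) _.
  by rewrite -mapE flift_fsubst; apply: IH1.
Qed.

(** * Soundness and completeness *)

(* The carrier is a parameter, not a field: its universe must be allowed to lie
   below that of interpretation domains for the models over [term], and above
   it for the models over [tree]. *)
Record structure (U : Type) : Type := Structure {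
  elem : U -> U -> Prop;
  incl : U -> U -> Prop;
  cup : U -> U -> U;
  diff : U -> U -> U;
  pow : U -> U
}.

Fixpoint eval (U : Type) (M : structure U) (rho : nat -> U) (t : term) : U :=
  match t with
  | Var n => rho n
  | Cup s t => cup M (eval M rho s) (eval M rho t)
  | Diff s t => diff M (eval M rho s) (eval M rho t)
  | Pow t => pow M (eval M rho t)
  end.

Fixpoint sat (U : Type) (M : structure U) (rho : nat -> U) (phi : formula) : Prop :=
  match phi with
  | Elem s t => elem M (eval M rho s) (eval M rho t)
  | Incl s t => incl M (eval M rho s) (eval M rho t)
  | Bot => False
  | Imp a b => sat M rho a -> sat M rho b
  | And a b => sat M rho a /\ sat M rho b
  | Or a b => sat M rho a \/ sat M rho b
  | All a => forall u, sat M (scons u rho) a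
  | Ex a => exists u, sat M (scons u rho) a
  end.

Lemma eval_tsubst (U : Type) (M : structure U) (rho : nat -> U) s t :
  eval M rho (tsubst s t) = eval M (fun n => eval M rho (s n)) t.
Proof. by elim: t => //= [t -> t' ->|t -> t' ->|t ->]. Qed.

Lemma eval_up (U : Type) (M : structure U) (rho : nat -> U) s u :
  (fun n => eval M (scons u rho) (up s n)) = scons u (fun n => eval M rho (s n)).
Proof.
by apply: functional_extensionality; case=> //= n; rewrite eval_tsubst.
Qed.

Lemma sat_fsubst (U : Type) (M : structure U) (rho : nat -> U) s phi :
  sat M rho (fsubst s phi) <-> sat M (fun n => eval M rho (s n)) phi.
Proof.
elim: phi rho s => //= [t t'|t t'|a IHa b IHb|a IHa b IHb|a IHa b IHb|a IHa|a IHa]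
  rho s; rewrite ?eval_tsubst ?IHa ?IHb //.
- by split=> H u; move: (H u); rewrite IHa eval_up.
- by split=> -[u H]; exists u; move: H; rewrite IHa eval_up.
Qed.

Lemma sat_flift (U : Type) (M : structure U) (rho : nat -> U) u phi :
  sat M (scons u rho) (flift phi) <-> sat M rho phi.
Proof. by rewrite sat_fsubst. Qed.

Lemma sat_finst (U : Type) (M : structure U) (rho : nat -> U) t phi :
  sat M rho (finst phi t) <-> sat M (scons (eval M rho t) rho) phi.
Proof.
rewrite sat_fsubst (_ : (fun n => _) = scons (eval M rho t) rho) //.
by apply: functional_extensionality; case.
Qed.

Lemma soundness G phi (U : Type) (M : structure U) (rho : nat -> U) :
  derivable G phi -> (forall psi, psi \in G -> sat M rho psi) -> sat M rho phi.
Proof.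
have cons_sat (L : seq formula) psi (r : nat -> U) : sat M r psi ->
    (forall chi, chi \in L -> sat M r chi) ->
    forall chi, chi \in psi :: L -> sat M r chi.
  by move=> satpsi satL chi; rewrite inE => /orP[/eqP->|/satL].
have lift_sat (L : seq formula) u (r : nat -> U) :
    (forall chi, chi \in L -> sat M r chi) ->
    forall chi, chi \in map flift L -> sat M (scons u r) chi.
  by move=> satL _ /mapP[chi /satL chiL ->]; rewrite sat_flift.
move=> d; elim: d rho => {G phi} /=.
- by move=> G phi phiG rho; apply.
- move=> G phi _ IH rho satG; apply: NNPP => nphi.
  by apply: (IH rho); apply: cons_sat.
- by move=> G phi psi _ IH rho satG satphi; apply: IH; apply: cons_sat.
- by move=> G phi psi _ IH1 _ IH2 rho satG; apply: IH1 (IH2 _ _).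
- by move=> G phi psi _ IH1 _ IH2 rho satG; split; [apply: IH1|apply: IH2].
- by move=> G phi psi _ IH rho /IH[].
- by move=> G phi psi _ IH rho /IH[].
- by move=> G phi psi _ IH rho /IH; left.
- by move=> G phi psi _ IH rho /IH; right.
- move=> G phi psi chi _ IH _ IH1 _ IH2 rho satG.
  by case: (IH rho satG) => [H|H]; [apply: IH1|apply: IH2]; apply: cons_sat.
- by move=> G phi _ IH rho satG u; apply: IH; apply: lift_sat.
- by move=> G phi t _ IH rho /IH H; rewrite sat_finst.
- by move=> G phi t _ IH rho /IH; rewrite sat_finst; exists (eval M rho t).
- move=> G phi chi _ IH _ IH1 rho satG; have [u satphi] := IH rho satG.
  apply/(sat_flift M rho u)/IH1/cons_sat => //; exact: lift_sat.
Qed.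

(** * Enumeration of formulas *)

Fixpoint term_code (t : term) : GenTree.tree nat :=
  match t with
  | Var n => GenTree.Leaf n
  | Cup s t => GenTree.Node 0 [:: term_code s; term_code t]
  | Diff s t => GenTree.Node 1 [:: term_code s; term_code t]
  | Pow t => GenTree.Node 2 [:: term_code t]
  end.

Fixpoint term_decode (c : GenTree.tree nat) : term :=
  match c with
  | GenTree.Leaf n => Var n
  | GenTree.Node 0 [:: s; t] => Cup (term_decode s) (term_decode t)
  | GenTree.Node 1 [:: s; t] => Diff (term_decode s) (term_decode t)
  | GenTree.Node _ [:: t] => Pow (term_decode t)
  | _ => Var 0
  end.

Lemma term_codeK : cancel term_code term_decode.
Proof. by elim=> //= [s -> t ->|s -> t ->|t ->]. Qed.

(** The tags 0 and 1 each serve twice; the number of children separates the two uses. *)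
Fixpoint formula_code (phi : formula) : GenTree.tree nat :=
  match phi with
  | Elem s t => GenTree.Node 0 [:: term_code s; term_code t]
  | Incl s t => GenTree.Node 1 [:: term_code s; term_code t]
  | Bot => GenTree.Leaf 0
  | Imp a b => GenTree.Node 2 [:: formula_code a; formula_code b]
  | And a b => GenTree.Node 3 [:: formula_code a; formula_code b]
  | Or a b => GenTree.Node 4 [:: formula_code a; formula_code b]
  | All a => GenTree.Node 0 [:: formula_code a]
  | Ex a => GenTree.Node 1 [:: formula_code a]
  end.

Fixpoint formula_decode (c : GenTree.tree nat) : formula :=
  match c with
  | GenTree.Node 0 [:: s; t] => Elem (term_decode s) (term_decode t)
  | GenTree.Node 1 [:: s; t] => Incl (term_decode s) (term_decode t)
  | GenTree.Node 2 [:: a; b] => Imp (formula_decode a) (formula_decode b)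
  | GenTree.Node 3 [:: a; b] => And (formula_decode a) (formula_decode b)
  | GenTree.Node 4 [:: a; b] => Or (formula_decode a) (formula_decode b)
  | GenTree.Node 0 [:: a] => All (formula_decode a)
  | GenTree.Node 1 [:: a] => Ex (formula_decode a)
  | _ => Bot
  end.

Lemma formula_codeK : cancel formula_code formula_decode.
Proof.
by elim=> //= [s t|s t|a -> b ->|a -> b ->|a -> b ->|a ->|a ->];
   rewrite ?term_codeK.
Qed.

(** * Henkin theories *)

Definition consistent (G : seq formula) : Prop := ~ derivable G Bot.

(** Contexts are finite lists, so a fresh variable always exists and plays the role of the Henkin
    constant; the language is not extended. *)
Definition henkin_step (G : seq formula) (psi : formula) : seq formula :=
  if excluded_middle_informative (derivable (psi :: G) Bot) then G
  else if psi is Ex chi then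
    finst chi (Var (\max_(theta <- psi :: chi :: G) fbound theta)) :: psi :: G
  else psi :: G.

(* [m] is fresh, so renaming it to [Var 0] turns a refutation of the witness
   into the eigenvariable premise of [ExE]. *)
Lemma witness_consistent G chi m :
  consistent (Ex chi :: G) ->
  (forall theta, theta \in Ex chi :: chi :: G -> fbound theta <= m) ->
  consistent (finst chi (Var m) :: Ex chi :: G).
Proof.
move=> con bound d; apply: con.
pose s n := if n == m then Var 0 else Var n.+1.
have sE theta : theta \in Ex chi :: G -> fsubst s theta = flift theta.
  move=> thetaG; apply: fsubst_eq => n ltn; rewrite /s.
  have : n < m.
    by apply: leq_trans ltn (bound _ _); move: thetaG; rewrite !inE;
      case/orP=> ->; rewrite ?orbT.
  by rewrite ltn_neqAle => /andP[/negPf->].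
(* [s] turns the witness into [Var 0] and shifts the other free variables, which is how they appear
   under the binder in [chi]. *)
have chiE : fsubst s (finst chi (Var m)) = chi.
  rewrite fsubst_finst finst_fsubst_up /= {1}/s eqxx -[RHS]fsubst_id.
  apply: fsubst_eq => -[|n] //= ltn; rewrite /s.
  have : n.+1 < m.+1.
    by apply: leq_trans ltn (leqW (bound _ _)); rewrite !inE eqxx orbT.
  by rewrite ltnS ltn_neqAle => /andP[/negPf->].
have := derivable_subst s d; rewrite [map _ _]/= chiE => d'.
apply: (@ExE _ chi); first by apply: Ax; rewrite mem_head.
apply: derivable_weaken d' _ => theta.
rewrite inE => /orP[/eqP->|]; first exact: mem_head.
rewrite -[_ :: _]/(map (fsubst s) (Ex chi :: G)) => /mapP[psi psiG ->].
by rewrite inE sE // map_f ?orbT.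
Qed.

Lemma henkin_step_consistent G psi :
  consistent G -> consistent (henkin_step G psi).
Proof.
move=> con; rewrite /henkin_step; case: excluded_middle_informative => // ncon.
case: psi ncon => // chi ncon; apply: witness_consistent => // theta thetaG.
exact: leq_bigmax_seq thetaG isT.
Qed.

Lemma henkin_step_sub G psi : {subset G <= henkin_step G psi}.
Proof.
move=> theta thetaG; rewrite /henkin_step.
case: excluded_middle_informative => //= ?.
by case: (psi) => *; rewrite !inE thetaG !orbT.
Qed.

Lemma henkin_stepP G psi :
  derivable (psi :: G) Bot \/
  psi \in henkin_step G psi /\
  forall chi, psi = Ex chi -> exists t, finst chi t \in henkin_step G psi.
Proof.
rewrite /henkin_step; case: excluded_middle_informative => /= [|_]; first by left.
right; split=> [|chi ->]; first by case: psi => *; rewrite !inE eqxx ?orbT.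
by eexists; apply: mem_head.
Qed.

(** Each formula is the decoding of some [c] and is treated in passing from stage [pickle c] to the
    next. *)
Fixpoint henkin_stage (G : seq formula) (n : nat) : seq formula :=
  if n is m.+1 then
    if unpickle m is Some c then
      henkin_step (henkin_stage G m) (formula_decode c)
    else henkin_stage G m
  else G.

(** Derivability from a single finite stage replaces derivability from the infinite union. *)
Definition henkin_theory (G : seq formula) (psi : formula) : Prop :=
  exists n, derivable (henkin_stage G n) psi.

Lemma henkin_stage_consistent G n : consistent G -> consistent (henkin_stage G n).
Proof.
move=> con; elim: n => //= n IH.
by case: (unpickle n) => // c; apply: henkin_step_consistent.
Qed.

Lemma henkin_stage_sub G m n :
  m <= n -> {subset henkin_stage G m <= henkin_stage G n}.
Proof.
elim: n => [|n IH]; first by case: m => // _ x.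
rewrite leq_eqVlt ltnS => /orP[/eqP-> x //|/IH mn] psi /mn psin /=.
by case: (unpickle n) => // c; apply: henkin_step_sub.
Qed.

Lemma henkin_stageP G psi : exists n,
  derivable (psi :: henkin_stage G n) Bot \/
  psi \in henkin_stage G n.+1 /\
  forall chi, psi = Ex chi -> exists t, finst chi t \in henkin_stage G n.+1.
Proof.
exists (pickle (formula_code psi)); rewrite /= pickleK formula_codeK.
exact: henkin_stepP.
Qed.

(** Each hypothesis is moved into the conclusion by [ImpI]; the stages increase, so two of them
    combine at their maximum. *)
Lemma henkin_theory_deduce G L phi :
  (forall psi, psi \in L -> henkin_theory G psi) -> derivable L phi ->
  henkin_theory G phi.
Proof.
elim: L phi => [|a L IH] phi HL d.
  by exists 0; apply: derivable_weaken d _.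
have [|n dn] := IH (Imp a phi) _ (ImpI d).
  by move=> psi psiL; apply: HL; rewrite inE psiL orbT.
have [m dm] := HL a (mem_head _ _); exists (maxn m n).
apply: (@ImpE _ a); first apply: derivable_weaken dn _.
  exact/henkin_stage_sub/leq_maxr.
by apply: derivable_weaken dm _; apply/henkin_stage_sub/leq_maxl.
Qed.

Lemma henkin_theory_Bot G : consistent G -> ~ henkin_theory G Bot.
Proof. by move=> con [n]; apply: henkin_stage_consistent. Qed.

Lemma henkin_theory_deduce1 G a b :
  henkin_theory G a -> derivable [:: a] b -> henkin_theory G b.
Proof.
by move=> Ha; apply: henkin_theory_deduce => psi; rewrite inE => /eqP->.
Qed.

Lemma henkin_theory_deduce2 G a b c :
  henkin_theory G a -> henkin_theory G b -> derivable [:: a; b] c ->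
  henkin_theory G c.
Proof.
move=> Ha Hb; apply: henkin_theory_deduce => psi.
by rewrite !inE => /orP[]/eqP->.
Qed.

(** Maximality: the stage that treats [psi] either refutes it or adds it. *)
Lemma henkin_theory_Not G psi :
  ~ henkin_theory G psi -> henkin_theory G (Not psi).
Proof.
move=> npsi; have [n [d|[psin _]]] := henkin_stageP G psi.
  by exists n; apply: ImpI.
by case: npsi; exists n.+1; apply: Ax.
Qed.

Lemma henkin_theory_witness G chi :
  consistent G -> henkin_theory G (Ex chi) ->
  exists t, henkin_theory G (finst chi t).
Proof.
move=> con Hchi; have [n [d|[_ /(_ _ erefl)[t tn]]]] := henkin_stageP G (Ex chi).
  case: (henkin_theory_Bot con); apply: (@henkin_theory_deduce2 _ (Not (Ex chi))) Hchi _.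
    by exists n; apply: ImpI d.
  by apply: (@ImpE _ (Ex chi)); apply: Ax; rewrite !inE eqxx ?orbT.
by exists t, n.+1; apply: Ax.
Qed.

Ltac hyp := apply: Ax; rewrite !inE eqxx ?orbT //.

Lemma derivable_ex_falso G phi : derivable G Bot -> derivable G phi.
Proof.
move=> d; apply: Contra; apply: derivable_weaken d _ => x xG.
by rewrite inE xG orbT.
Qed.

Lemma derivable_Not_All G phi :
  Not (All phi) \in G -> derivable G (Ex (Not phi)).
Proof.
move=> nphi; apply: Contra; apply: (@ImpE _ (All phi)).
  by apply: Ax; rewrite inE nphi orbT.
(* If no counterexample exists, [phi] holds at the eigenvariable by contradiction: [Not phi] there
   would witness the lifted existential formula. *)
apply/AllI/Contra; apply: (@ImpE _ (flift (Ex (Not phi)))).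
  by apply: Ax; rewrite !inE eqxx orbT.
by apply: (@ExI _ _ (Var 0)); rewrite (finst_lift (Not phi)); hyp.
Qed.

(** * The term model *)

(** Terms denote themselves; no quotient is taken because the language has no equality. *)
Definition henkin_structure (G : seq formula) : structure term :=
  @Structure term (fun s t => henkin_theory G (Elem s t))
    (fun s t => henkin_theory G (Incl s t)) Cup Diff Pow.

Lemma eval_henkin G s t : eval (henkin_structure G) s t = tsubst s t.
Proof. by elim: t => //= [t -> t' ->|t -> t' ->|t ->]. Qed.

(** The truth lemma. A valuation in the term model is a substitution, so the statement ranges over
    all [s] and a quantifier step becomes instantiation by a term. *)
Lemma sat_henkin G s phi : consistent G ->
  sat (henkin_structure G) s phi <-> henkin_theory G (fsubst s phi).
Proof.
move=> con; have nBot := henkin_theory_Bot con.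
elim: phi s => /= [t t'|t t'||a IHa b IHb|a IHa b IHb|a IHa b IHb|a IHa|a IHa] s.
- by rewrite !eval_henkin.
- by rewrite !eval_henkin.
- by split.
- rewrite IHa IHb; split=> [Hab|Hab Ha].
    have [/Hab Hb|/henkin_theory_Not Ha] := classic (henkin_theory G (fsubst s a)).
      by apply: henkin_theory_deduce1 Hb _; apply: ImpI; hyp.
    apply: henkin_theory_deduce1 Ha _; apply/ImpI/derivable_ex_falso.
    by apply: (@ImpE _ (fsubst s a)); hyp.
  by apply: henkin_theory_deduce2 Hab Ha _; apply: (@ImpE _ (fsubst s a)); hyp.
- rewrite IHa IHb; split=> [[Ha Hb]|Hab].
    by apply: henkin_theory_deduce2 Ha Hb _; apply: AndI; hyp.
  split; apply: henkin_theory_deduce1 Hab _.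
    by apply: (@AndE1 _ _ (fsubst s b)); hyp.
  by apply: (@AndE2 _ (fsubst s a)); hyp.
- rewrite IHa IHb; split=> [[Ha|Hb]|Hab].
  + by apply: henkin_theory_deduce1 Ha _; apply: OrI1; hyp.
  + by apply: henkin_theory_deduce1 Hb _; apply: OrI2; hyp.
  have [|/henkin_theory_Not Ha] := classic (henkin_theory G (fsubst s a)).
    by left.
  right; apply: henkin_theory_deduce2 Hab Ha _.
  apply: (@OrE _ (fsubst s a) (fsubst s b)); [by hyp| |by hyp].
  by apply: derivable_ex_falso; apply: (@ImpE _ (fsubst s a)); hyp.
- split=> [Ha|Ha t]; last first.
    rewrite IHa -finst_fsubst_up; apply: henkin_theory_deduce1 Ha _.
    by apply: AllE; hyp.
  (* Otherwise the theory contains the negated universal formula, hence some witness [t] against it,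
     and [Ha t] contradicts this. *)
  apply: NNPP => /henkin_theory_Not nAll.
  have [|t nt] := @henkin_theory_witness G (Not (fsubst (up s) a)) con.
    by apply: henkin_theory_deduce1 nAll _; apply: derivable_Not_All; apply: mem_head.
  apply: nBot; move/IHa: (Ha t); rewrite -finst_fsubst_up => Ht.
  apply: henkin_theory_deduce2 nt Ht _.
  by apply: (@ImpE _ (finst (fsubst (up s) a) t)); hyp.
- split=> [[t]|/(henkin_theory_witness con)[t]].
    rewrite IHa -finst_fsubst_up => Ht; apply: henkin_theory_deduce1 Ht _.
    by apply: (@ExI _ _ t); hyp.
  by rewrite finst_fsubst_up => Ht; exists t; rewrite IHa.
Qed.

(** If [Not phi :: G] were consistent, its term model under the valuation [Var] would be a
    countermodel. *)
Lemma completeness G phi :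
  (forall (U : Type) (M : structure U) (rho : nat -> U),
     (forall psi, psi \in G -> sat M rho psi) -> sat M rho phi) ->
  derivable G phi.
Proof.
move=> valid; apply: Contra; apply: NNPP => con.
have satE psi := @sat_henkin _ Var psi con.
have satH psi : psi \in Not phi :: G ->
    sat (henkin_structure (Not phi :: G)) Var psi.
  by move=> psiG; rewrite satE fsubst_id; exists 0; apply: Ax.
apply: (satH (Not phi) (mem_head _ _)); apply: valid => psi psiG.
by apply: satH; rewrite inE psiG orbT.
Qed.

(** Quantifying over whole valuations handles a prefix of any length in one step. *)
Lemma sat_iter_All (U : Type) (M : structure U) (rho : nat -> U) n phi :
  sat M rho (iter n All phi) <->
  forall rho', (forall i, rho' (n + i) = rho i) -> sat M rho' phi.
Proof.
elim: n phi => [|n IH] phi.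
  split=> [H rho' E|H]; last by apply: H.
  by rewrite (_ : rho' = rho) //; apply: functional_extensionality.
rewrite iterSr IH; split=> H rho' E /=.
  by rewrite (scons_eta rho'); apply: H => i; rewrite -E.
by move=> u; apply: H.
Qed.

(** * Models of the set theory *)

Definition Omega_model (U : Type) (M : structure U) : Prop :=
  [/\ forall a b c : U, elem M a (cup M b c) <-> elem M a b \/ elem M a c,
      forall a b c : U, elem M a (diff M b c) <-> elem M a b /\ ~ elem M a c,
      forall a b : U, incl M a b <-> forall c, elem M c a -> elem M c b
    & forall a b : U, elem M a (pow M b) <-> incl M a b].

Lemma sat_Omega (U : Type) (M : structure U) (rho : nat -> U) :
  (forall psi, psi \in Omega -> sat M rho psi) <-> Omega_model M.
Proof.
split=> [H|[cupE diffE inclE powE] psi].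
  have [Hcup Hdiff Hincl Hpow] :
      [/\ sat M rho ax_cup, sat M rho ax_diff, sat M rho ax_incl & sat M rho ax_pow].
    by split; apply: H; rewrite !inE eqxx ?orbT.
  split=> [a b c|a b c|a b|a b].
  - by have [] := Hcup a b c.
  - by have [] := Hdiff a b c.
  - by have [] := Hincl a b.
  - by have [] := Hpow a b.
rewrite !inE => /or4P[]/eqP-> /=.
- by move=> a b c; have [] := cupE a b c.
- by move=> a b c; have [] := diffE a b c.
- by move=> a b; have [] := inclE a b.
- by move=> a b; have [] := powE a b.
Qed.

Lemma elem_Cap (U : Type) (M : structure U) (rho : nat -> U) a s t :
  Omega_model M ->
  elem M a (eval M rho (Cap s t)) <-> elem M a (eval M rho s) /\ elem M a (eval M rho t).
Proof.
move=> [_ diffE _ _] /=; rewrite !diffE; split=> [[As nA]|[As At]].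
  by split=> //; apply: NNPP => nt; apply: nA.
by split=> // -[_]; apply.
Qed.

Lemma elem_xy_union (NC : Type) (NR : eqType) (Rs : seq NR) (As : seq NC)
    (U : Type) (M : structure U) (rho : nat -> U) a :
  Omega_model M ->
  elem M a (eval M rho (xy_union Rs As)) <->
  elem M a (eval M rho (x_var Rs As)) \/
  exists2 R, R \in Rs & elem M a (eval M rho (y_var Rs As R)).
Proof.
move=> [cupE _ _ _]; rewrite /xy_union.
(* The induction needs an arbitrary accumulator [t], and a list [Ss] apart from the fixed [Rs] that
   determines the indices in [y_var]. *)
have gen (Ss : seq NR) t :
    elem M a (eval M rho (foldl (fun t R => Cup t (y_var Rs As R)) t Ss)) <->
    elem M a (eval M rho t) \/
    exists2 R, R \in Ss & elem M a (eval M rho (y_var Rs As R)).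
  elim: Ss t => [|R Ss IH] t /=.
    by split=> [|[|[]]//]; left.
  rewrite IH /= cupE; split=> [[[|aR]|[S SSs aS]]|[|[S]]].
  - by left.
  - by right; exists R; rewrite ?mem_head.
  - by right; exists S; rewrite // inE SSs orbT.
  - by left; left.
  - by rewrite inE => /orP[/eqP->|SSs] aS; [left; right|right; exists S].
exact: gen.
Qed.

Lemma sat_Incl_Cap (U : Type) (M : structure U) (rho : nat -> U) s t u :
  Omega_model M ->
  sat M rho (Incl (Cap s t) u) <->
  forall a, elem M a (eval M rho s) -> elem M a (eval M rho t) -> elem M a (eval M rho u).
Proof.
move=> OM; have [_ _ inclE _] := OM.
rewrite -[sat _ _ _]/(incl M (eval M rho (Cap s t)) (eval M rho u)) inclE.
split=> H a; last by rewrite elem_Cap // => -[]; apply: H.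
by move=> As At; apply: H; rewrite elem_Cap.
Qed.

(* The last clause decodes [R_i] as two membership steps, through a member of
   [f d] that lies in [y_i] or outside [x \cup y_1 \cup ... \cup y_k]. *)
Definition encodes (NC NR : eqType) (Rs : seq NR) (As : seq NC)
    (I : interpretation NC NR) (U : Type) (M : structure U) (rho : nat -> U)
    (f : domain I -> U) : Prop :=
  [/\ forall a, elem M a (eval M rho (x_var Rs As)) <-> exists d, a = f d,
      forall A d, A \in As ->
        name_int A d <-> elem M (f d) (eval M rho (name_var As A))
    & forall R d a, R \in Rs ->
        (exists2 e, role_int R d e & a = f e) <->
        exists t, [/\ elem M t (f d), elem M a t &
          ~ elem M t (eval M rho (Diff (xy_union Rs As) (y_var Rs As R)))]].

(** * Correctness of the translation *)

Section Translation.
Context (NC NR : eqType) (Rs : seq NR) (As : seq NC) (I : interpretation NC NR).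
Context (U : Type) (M : structure U) (rho : nat -> U) (f : domain I -> U).
Context (OM : Omega_model M) (enc : encodes Rs As M rho f).

(** A set lies in the outer [Pow] when each of its members is in the difference or is a subset of
    [t]. The members outside the difference are the intermediate sets through which [encodes] reads
    [R]. *)
Lemma elem_all_set R t d : R \in Rs ->
  elem M (f d) (eval M rho (all_set Rs As R t)) <->
  forall e, role_int R d e -> elem M (f e) (eval M rho t).
Proof.
move=> RRs; have [_ _ /(_ R d _ RRs) roleE] := enc.
have [cupE _ inclE powE] := OM.
rewrite /all_set /= powE inclE; split=> [H e de|H c cd].
  have /roleE[c [cd ec nc]] : exists2 e', role_int R d e' & f e = f e' by exists e.
  by move: (H c cd); rewrite cupE powE inclE => -[/nc //|]; apply.
rewrite cupE powE inclE.
have [|ncD] := classic (elem M c (eval M rho (Diff (xy_union Rs As) (y_var Rs As R)))).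
  by left.
right=> a ac.
have /roleE[e de ->] : exists t0, [/\ elem M t0 (f d), elem M a t0 &
  ~ elem M t0 (eval M rho (Diff (xy_union Rs As) (y_var Rs As R)))] by exists c.
exact: H.
Qed.

(** Every [f d] belongs to [x], so difference from [x] acts as complement; the existential case is
    the classical dual of the universal one. *)
Lemma elem_concept_set (C : concept NC NR) d :
  {subset role_names C <= Rs} -> {subset concept_names C <= As} ->
  extension C d <-> elem M (f d) (eval M rho (concept_set Rs As C)).
Proof.
have [xE nameE _] := enc; have [cupE diffE _ _] := OM.
have fx e : elem M (f e) (eval M rho (x_var Rs As)) by apply/xE; exists e.
have sub (X : eqType) (s t u : seq X) :
    {subset s ++ t <= u} -> {subset s <= u} /\ {subset t <= u}.
  by move=> st; split=> v vs; apply: st; rewrite mem_cat vs ?orbT.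
elim: C d => [||A|C IH|C IHC D IHD|C IHC D IHD|R C IH|R C IH] d /= subR subA.
- by split.
- by rewrite diffE; split=> // -[].
- by apply: nameE; apply: subA; rewrite mem_head.
- by rewrite diffE IH //; split=> [|[]//]; split.
- have [[? ?] [? ?]] := (sub _ _ _ _ subR, sub _ _ _ _ subA).
  by rewrite IHC // IHD // elem_Cap.
- have [[? ?] [? ?]] := (sub _ _ _ _ subR, sub _ _ _ _ subA).
  by rewrite cupE IHC // IHD.
- have subRC : {subset role_names C <= Rs}.
    by move=> S SC; apply: subR; rewrite inE SC orbT.
  rewrite (@elem_all_set R (concept_set Rs As C));
    last by apply: subR; rewrite mem_head.
  by split=> H e /H; rewrite IH.
- have subRC : {subset role_names C <= Rs}.
    by move=> S SC; apply: subR; rewrite inE SC orbT.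
  rewrite diffE (@elem_all_set R (Diff (x_var Rs As) (concept_set Rs As C)));
    last by apply: subR; rewrite mem_head.
  split=> [[e de Ce]|[_ nall]].
    by split=> // /(_ e de) /=; rewrite diffE -IH // => -[].
  apply: NNPP => nex; apply: nall => e de /=; rewrite diffE -IH //.
  by split=> // Ce; apply: nex; exists e.
Qed.

(** Intersecting with [x] confines the inclusion to the sets [f d]: the power set that translates a
    universal restriction may have members outside [x]. *)
Lemma sat_incl_formula (C D : concept NC NR) :
  {subset role_names C <= Rs} -> {subset concept_names C <= As} ->
  {subset role_names D <= Rs} -> {subset concept_names D <= As} ->
  sat M rho (incl_formula Rs As C D) <-> satisfies_incl I C D.
Proof.
move=> subRC subAC subRD subAD; have [xE _ _] := enc.
rewrite sat_Incl_Cap //; split=> [H d|H a Ca /xE[d aE]].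
  by rewrite !elem_concept_set // => Cd; apply: H => //; rewrite xE; exists d.
by move: Ca; rewrite aE -!elem_concept_set //; apply: H.
Qed.

Lemma sat_tbox_formulas (T : tbox NC NR) :
  {subset tbox_role_names T <= Rs} -> {subset tbox_concept_names T <= As} ->
  sat M rho (BigAnd (tbox_formulas Rs As T)) <-> satisfies_tbox I T.
Proof.
elim: T => [|[C D] T IH] subR subA /=; first by split=> // _ [].
have sub (X : eqType) (s t u v : seq X) : {subset (s ++ t) ++ u <= v} ->
    [/\ {subset s <= v}, {subset t <= v} & {subset u <= v}].
  by move=> H; split=> a sa; apply: H; rewrite !mem_cat sa ?orbT.
have [? ? ?] := sub _ _ _ _ _ subR; have [? ? ?] := sub _ _ _ _ _ subA.
by rewrite IH // -sat_incl_formula.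
Qed.

End Translation.

(** * From set models to interpretations *)

(** The domain consists of the members of [x], and [a0] supplies the point it must have. *)
Lemma membership_encoding (NC NR : eqType) (Rs : seq NR) (As : seq NC)
    (U : Type) (M : structure U) (rho : nat -> U) (a0 : U)
    (x := eval M rho (x_var Rs As)) :
  Omega_model M -> elem M a0 x ->
  (forall a b, elem M a b -> elem M b x -> incl M a x) ->
  exists (I : interpretation NC NR) (f : domain I -> U),
    encodes Rs As M rho f.
Proof.
move=> [_ _ inclE _] a0x trans.
exists (@Interpretation NC NR {a | elem M a x} (exist _ a0 a0x)
  (fun A d => elem M (sval d) (eval M rho (name_var As A)))
  (fun R d e => exists t, [/\ elem M t (sval d), elem M (sval e) t &
    ~ elem M t (eval M rho (Diff (xy_union Rs As) (y_var Rs As R)))])).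
exists sval; split=> //= [a|R [d dx] a _ /=].
  by split=> [ax|[[b bx] ->]//]; exists (exist _ a ax).
split=> [[e H ->]//|[t [td ta nt]]].
have ax : elem M a x by move: (trans t d td dx); rewrite inclE; apply.
by exists (exist _ a ax) => //; exists t.
Qed.

(** * Sets over a binary relation on atoms *)

(** Atoms may have members, given by a relation that may have cycles, so cyclic roles fit beside the
    well-founded collections. *)
Inductive tree (B : Type) : Type :=
| Atom of B
| Coll (J : Type) of J -> tree B.

(** An atom is never related to a collection, even one with the same members; this is harmless
    because extensionality is not among the axioms. *)
Fixpoint bisim (B : Type) (s t : tree B) {struct s} : Prop :=
  match s, t with
  | Atom b, Atom c => b = c
  | Coll J f, Coll K g =>
      (forall i, exists j, bisim (f i) (g j)) /\
      (forall j, exists i, bisim (f i) (g j))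
  | _, _ => False
  end.

Lemma bisim_refl (B : Type) (s : tree B) : bisim s s.
Proof. by elim: s => //= J f IH; split=> i; exists i. Qed.

Lemma bisim_sym (B : Type) (s t : tree B) : bisim s t -> bisim t s.
Proof.
elim: s t => [b|J f IH] [c|K g] //= [fg gf]; split=> i.
  by have [j /IH] := gf i; exists j.
by have [j /IH] := fg i; exists j.
Qed.

Lemma bisim_trans (B : Type) (s t u : tree B) :
  bisim s t -> bisim t u -> bisim s u.
Proof.
elim: s t u => [b|J f IH] [c|K g] [d|L h] //=; first by move->.
move=> [fg gf] [gh hg]; split=> i.
  by have [j fgj] := fg i; have [k] := gh j; exists k; apply: IH fgj _.
by have [j ghj] := hg i; have [k fgk] := gf j; exists k; apply: IH fgk _.
Qed.

(** Worlds are atoms, so this is what lets [encodes] describe the members of [x] by plain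
    equality. *)
Lemma bisim_Atom (B : Type) (s : tree B) b : bisim s (Atom b) -> s = Atom b.
Proof. by case: s => //= c ->. Qed.

Definition branch_index (B : Type) (e : B -> B -> Prop) (t : tree B) : Type :=
  match t with Atom b => {c | e c b} | Coll J _ => J end.

Definition branch (B : Type) (e : B -> B -> Prop) (t : tree B) :
    branch_index e t -> tree B :=
  match t return branch_index e t -> tree B with
  | Atom b => fun c => Atom (sval c)
  | Coll _ f => f
  end.

Definition tree_elem (B : Type) (e : B -> B -> Prop) (s t : tree B) : Prop :=
  exists i : branch_index e t, bisim s (branch i).

Definition tree_incl (B : Type) (e : B -> B -> Prop) (s t : tree B) : Prop :=
  forall u, tree_elem e u s -> tree_elem e u t.

Definition tree_cup (B : Type) (e : B -> B -> Prop) (s t : tree B) : tree B :=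
  Coll (fun i : branch_index e s + branch_index e t =>
    match i with inl j => branch j | inr j => branch j end).

Definition tree_diff (B : Type) (e : B -> B -> Prop) (s t : tree B) : tree B :=
  Coll (fun i : {i : branch_index e s | ~ tree_elem e (branch i) t} =>
    branch (sval i)).

(** A subset of [t] is an atom, or a collection bisimilar to one cut out by a predicate on the
    branches of [t]; the two summands provide both kinds. *)
Definition tree_pow (B : Type) (e : B -> B -> Prop) (t : tree B) : tree B :=
  Coll (fun i : {b | tree_incl e (Atom b) t} + (branch_index e t -> Prop) =>
    match i with
    | inl b => Atom (sval b)
    | inr P => Coll (fun j : {j | P j} => branch (sval j))
    end).

Definition tree_structure (B : Type) (e : B -> B -> Prop) : structure (tree B) :=
  @Structure (tree B) (tree_elem e) (tree_incl e)
    (tree_cup e) (tree_diff e) (tree_pow e).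

Lemma tree_elem_Atom (B : Type) (e : B -> B -> Prop) s b :
  tree_elem e s (Atom b) <-> exists2 c, e c b & s = Atom c.
Proof.
split=> [[[c cb] /= sc]|[c cb ->]]; first by exists c; rewrite ?(bisim_Atom sc).
by exists (exist _ c cb).
Qed.

Lemma tree_elem_bisiml (B : Type) (e : B -> B -> Prop) s s' t :
  bisim s s' -> tree_elem e s t -> tree_elem e s' t.
Proof.
by move=> ss' [i si]; exists i; apply: bisim_trans si; apply: bisim_sym.
Qed.

Lemma tree_elem_bisimr (B : Type) (e : B -> B -> Prop) s t t' :
  bisim t t' -> tree_elem e s t -> tree_elem e s t'.
Proof.
case: t t' => [b|J f] [c|K g] //=; first by move->.
move=> [fg _] [i si]; have [j ij] := fg i; exists j.
exact: bisim_trans si ij.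
Qed.

Lemma tree_Omega_model (B : Type) (e : B -> B -> Prop) :
  Omega_model (tree_structure e).
Proof.
split=> [a b c|a b c|//|a b] /=.
- split=> [[[i|i] ai]|[[i ai]|[i ai]]].
  + by left; exists i.
  + by right; exists i.
  + by exists (inl i).
  + by exists (inr i).
- split=> [[[i nic] ai]|[[i ai] nac]].
    by split=> [|/(tree_elem_bisiml ai)]; first by exists i.
  have nic : ~ tree_elem e (branch i) c.
    by move/(tree_elem_bisiml (bisim_sym ai)).
  by exists (exist _ i nic).
split=> [[i ai]|ab].
  case: i ai => [[c cb]|P] /= ai; [by rewrite (bisim_Atom ai)|move=> u].
  by move=> /(tree_elem_bisimr ai)[[j Pj] uj]; exists j.
case: a ab => [c|J f] ab; first by exists (inl (exist _ c ab)).
(* The predicate keeps the branches of [b] that are members of the given collection. *)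
exists (inr (fun j => tree_elem e (branch j) (Coll f))); split=> [i|[j [i ji]]].
  have [|j ij] := ab (f i); first by exists i; apply: bisim_refl.
  have jf : tree_elem e (branch j) (Coll f) by exists i; apply: bisim_sym.
  by exists (exist _ j jf).
by exists i; apply: bisim_sym.
Qed.

(** * From interpretations to set models *)

(* [inl w] stands for a world [w], whose members are the [inr (w, R)] with
   [R \in Rs]; the members of [inr (w, R)] are the [R]-successors of [w]. *)
Definition frame_rel (NC NR : eqType) (Rs : seq NR) (I : interpretation NC NR)
    (c b : domain I + domain I * NR) : Prop :=
  match c, b with
  | inr (w, R), inl v => w = v /\ R \in Rs
  | inl v, inr (w, R) => role_int R w v
  | _, _ => False
  end.

Definition world (NC NR : eqType) (I : interpretation NC NR) (w : domain I) :
    tree (domain I + domain I * NR) :=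
  Atom (inl w).

(** The list follows the quantifier prefix after [x] and is reversed because index 0 is the
    innermost variable. The index of [x] is the length of the list, so [x] gets the default, the
    collection of all worlds. *)
Definition tree_valuation (NC NR : eqType) (Rs : seq NR) (As : seq NC)
    (I : interpretation NC NR) (i : nat) : tree (domain I + domain I * NR) :=
  nth (Coll (@world NC NR I))
    (rev ([seq Coll (fun w => Atom (inr (w, R))) | R <- Rs] ++
          [seq Coll (fun w : {w | name_int A w} => world (sval w)) | A <- As])) i.

Lemma tree_valuation_x (NC NR : eqType) (Rs : seq NR) (As : seq NC)
    (I : interpretation NC NR) :
  tree_valuation Rs As I (size As + size Rs) = Coll (@world NC NR I).
Proof.
by rewrite /tree_valuation nth_default // size_rev size_cat !size_map addnC.
Qed.

Lemma tree_valuation_y (NC NR : eqType) (Rs : seq NR) (As : seq NC)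
    (I : interpretation NC NR) R : R \in Rs ->
  tree_valuation Rs As I (size As + (size Rs - (index R Rs).+1)) =
  Coll (fun w => Atom (inr (w, R))).
Proof.
rewrite -index_mem => ltR.
rewrite /tree_valuation rev_cat nth_cat size_rev size_map.
rewrite ltnNge leq_addr /= addKn nth_rev size_map; last by rewrite subnSK ?leq_subr.
rewrite subnSK // subKn; last exact: ltnW.
by rewrite (nth_map R) // nth_index // -index_mem.
Qed.

Lemma tree_valuation_name (NC NR : eqType) (Rs : seq NR) (As : seq NC)
    (I : interpretation NC NR) A : A \in As ->
  tree_valuation Rs As I (size As - (index A As).+1) =
  Coll (fun w : {w | name_int A w} => world (sval w)).
Proof.
rewrite -index_mem => ltA.
have lt : size As - (index A As).+1 < size As by rewrite subnSK ?leq_subr.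
rewrite /tree_valuation rev_cat nth_cat size_rev size_map lt.
rewrite nth_rev size_map // subnSK // subKn; last exact: ltnW.
by rewrite (nth_map A) // nth_index // -index_mem.
Qed.

Lemma tree_encodes (NC NR : eqType) (Rs : seq NR) (As : seq NC)
    (I : interpretation NC NR) :
  encodes Rs As (tree_structure (@frame_rel NC NR Rs I))
    (tree_valuation Rs As I) (@world NC NR I).
Proof.
have yE R t : R \in Rs ->
    tree_elem (@frame_rel NC NR Rs I) t
      (tree_valuation Rs As I (size As + (size Rs - (index R Rs).+1))) <->
    exists w, t = Atom (inr (w, R)).
  move=> RRs; rewrite tree_valuation_y //.
  by split=> -[w]; [move=> /= tw; rewrite (bisim_Atom tw)|move->]; exists w.
split=> [a|A d AAs|R d a RRs].
- rewrite /= tree_valuation_x.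
  by split=> -[w]; [move=> /= tw; rewrite (bisim_Atom tw)|move->]; exists w.
- rewrite /= tree_valuation_name //; split=> [Ad|[[w Aw] [->]]//].
  by exists (exist _ d Ad).
have [_ diffE _ _] := tree_Omega_model (@frame_rel NC NR Rs I).
split=> [[v dv ->]|[t [/tree_elem_Atom[[//|[w S]] [-> SRs] ->]]]].
  (* The intermediate set is the atom [inr (d, R)], which lies in the value of [y_var Rs As R]. *)
  exists (Atom (inr (d, R))); split; [| |rewrite [eval _ _ _]/= diffE => -[_]; apply].
  + by apply/tree_elem_Atom; exists (inr (d, R)).
  + by apply/tree_elem_Atom; exists (inl v).
  + by apply/yE => //; exists d.
move=> /tree_elem_Atom[[v|[]//] dv ->]; rewrite diffE => nt.
(* Lying in the set of [R] forces [S = R]. Otherwise the atom would be in the set of [S] but not in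
   that of [R], hence in the excluded difference; this uses [S \in Rs], which [frame_rel]
   demands. *)
suff /(yE R)[//|? [_ <-]] : tree_elem (@frame_rel NC NR Rs I) (Atom (inr (d, S)))
    (eval (tree_structure (@frame_rel NC NR Rs I)) (tree_valuation Rs As I)
      (y_var Rs As R)).
  by exists v.
apply: NNPP => ntR; apply: nt; split=> //.
apply/elem_xy_union; first exact: tree_Omega_model.
by right; exists S => //; apply/yE => //; exists d.
Qed.

(** * Equivalence of entailment and derivability *)

(** [phi] stands outside the inner block of [n] quantifiers and sees only the tail of the
    valuation. *)
Lemma sat_iter_All_Imp (U : Type) (M : structure U) k n phi psi :
  (forall rho : nat -> U,
     sat M rho (All (iter k All (Imp phi (iter n All psi))))) <->
  (forall rho : nat -> U,
     sat M (fun i => rho (n + i)) phi -> sat M rho psi).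
Proof.
split=> [H rho satphi|H rho].
  have := H (fun i => rho (n + (k.+1 + i))).
  rewrite -[All _]/(iter k.+1 All _) sat_iter_All.
  move=> /(_ (fun i => rho (n + i)) (fun=> erefl) satphi).
  by move/sat_iter_All; apply.
rewrite -[All _]/(iter k.+1 All _) sat_iter_All => rho1 _ satphi.
apply/sat_iter_All => rho2 E2; apply: H.
by rewrite (_ : (fun i => _) = rho1) //; apply: functional_extensionality.
Qed.

(* [Rs] = R_1, ..., R_k and [As] = A_1, ..., A_n enumerate the names of T
   without repetition; under the prefix x, y_1, ..., y_k the variable x is
   [Var k]. *)
Theorem proposition5 (NC NR : eqType) (T : tbox NC NR)
    (Rs : seq NR) (Rs_uniq : uniq Rs) (Rs_names : Rs =i tbox_role_names T)
    (As : seq NC) (As_uniq : uniq As) (As_names : As =i tbox_concept_names T)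
    (C D : concept NC NR)
    (C_roles : {subset role_names C <= Rs})
    (C_names : {subset concept_names C <= As})
    (D_roles : {subset role_names D <= Rs})
    (D_names : {subset concept_names D <= As}) :
  alc_entails T C D <->
  derivable Omega
    (All (iter (size Rs) All
      (Imp (Trans2 (Var (size Rs)))
           (iter (size As) All
             (Imp (BigAnd (tbox_formulas Rs As T))
                  (incl_formula Rs As C D)))))).
Proof.
have T_roles : {subset tbox_role_names T <= Rs} by move=> R; rewrite Rs_names.
have T_names : {subset tbox_concept_names T <= As} by move=> A; rewrite As_names.
split=> [ent|d I IT].
  apply: completeness => U M rho0 /sat_Omega OM; move: rho0.
  apply/sat_iter_All_Imp => rho trans satT.
  apply/sat_Incl_Cap => // a aC ax.
  (* The member [a] of [x] under test makes the domain non-empty; for empty [x] there is nothing to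
     prove. *)
  have [|I [f enc]] := @membership_encoding NC NR Rs As U M rho a OM ax.
    by move=> b c bc cx; apply: (trans b c).
  apply: (sat_Incl_Cap _ _ _ _ OM).1 aC ax.
  by apply/(sat_incl_formula OM enc) => //; apply/ent/(sat_tbox_formulas OM enc).
pose M := tree_structure (@frame_rel NC NR Rs I).
have OM : Omega_model M := tree_Omega_model _.
have enc := @tree_encodes NC NR Rs As I.
apply/(sat_incl_formula OM enc) => //.
have [valid _] := sat_iter_All_Imp M (size Rs) (size As) (Trans2 (Var (size Rs)))
  (Imp (BigAnd (tbox_formulas Rs As T)) (incl_formula Rs As C D)).
apply: (valid _ (tree_valuation Rs As I)).
- by move=> rho; apply: soundness d _; apply/sat_Omega.
(* [Trans2] holds in the tree model: a member of a world is an atom [inr (v, R)], whose members are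
   worlds again. *)
- have [xE _ _] := enc => a b [] /= ab /xE[w bE] c ca; apply/xE.
  move: ab; rewrite bE => /tree_elem_Atom[[//|[v R]] _ aE].
  by move: ca; rewrite aE => /tree_elem_Atom[[u|[]//] _ ->]; exists u.
- exact/(sat_tbox_formulas OM enc).
Qed.
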